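(* Let $a>1$ be a real number and let $X$ be an absolutely continuous real random variable with probability density function $f$, cumulative distribution function $F$, support $(\ell,b)$ with $-\infty\le \ell<b<\infty$, finite second moment, and reversed hazard rate $\phi$. Suppose $E[a^X\phi(X)]<\infty$ and $E\left[\frac{1}{a^X\phi(X)}\right]<\infty$. Then $$E\left[\frac{1}{a^X\phi(X)}\right]\ \ge\ \frac{1}{E[a^X\phi(X)]},$$ and equality holds if and only if there is a constant $\theta>0$ such that $F(x)=e^{-\theta(a^{-x}-a^{-b})}$ for all $x\in(-\infty,b]$.
   Context: Saying that $X$ has support $(\ell,b)$ means that $\ell=\inf\{t:F(t)>0\}$, $b=\sup\{t:F(t)<1\}$, and $f(t)>0$ for almost every $t\in(\ell,b)$. The reversed hazard rate of $X$ is $\phi(t)=f(t)/F(t)$ for $t\in(\ell,b)$. *)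

(* Defs.v *)
From HB Require Import structures.
From mathcomp Require Import all_boot all_order all_algebra.
From mathcomp Require Import all_classical all_reals all_analysis.

Set Implicit Arguments.
Unset Strict Implicit.
Unset Printing Implicit Defensive.

Import Order.TTheory GRing.Theory Num.Theory.
Import numFieldNormedType.Exports.

Local Open Scope classical_set_scope.
Local Open Scope ring_scope.

Definition is_density (d : measure_display) (T : measurableType d)
    (R : realType) (P : probability T R) (X : {RV P >-> R}) (f : R -> R) : Prop :=
  [/\ measurable_fun [set: R] f,
      forall t : R, 0 <= f t
    & forall A : set R, measurable A ->
        distribution P X A = (\int[lebesgue_measure]_(t in A) (f t)%:E)%E].

Definition has_support (d : measure_display) (T : measurableType d)
    (R : realType) (P : probability T R) (X : {RV P >-> R}) (f : R -> R)
    (l b : \bar R) : Prop :=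
  [/\ l = ereal_inf (EFin @` [set t : R | (0 < cdf X t)%E]),
      b = ereal_sup (EFin @` [set t : R | (cdf X t < 1)%E])
    & {ae @lebesgue_measure R,
         forall t : R, (l < t%:E)%E -> (t%:E < b)%E -> 0 < f t}].

(* Only the values on the support (l, b) matter, where [cdf X t > 0].
   Outside of it, this is a total function (in particular [x / 0 = 0]), which
   does not affect expectations since [X] lies in (l, b) almost surely. *)
Definition reversed_hazard_rate (d : measure_display) (T : measurableType d)
    (R : realType) (P : probability T R) (X : {RV P >-> R}) (f : R -> R)
    (t : R) : R :=
  f t / fine (cdf X t).

(* Main.v *)
(* With Z = a^X phi(X), which is positive almost surely, and m = E[Z], the
   integral of (Z - m)^2 / Z shows that E[1/Z] >= 1/m, with equality if and only
   if Z = m almost surely. The latter says that f(t) = m a^(-t) F(t) for almost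
   every t < b, so that F is continuously differentiable there and solves
   F' = m a^(-t) F with F(b) = 1, i.e., F(x) = exp (- theta (a^(-x) - a^(-b)))
   for theta = m / ln a. Conversely, f = F' almost everywhere by Lebesgue's
   differentiation theorem, which gives back Z = theta ln a. *)
Require Import Defs.
From HB Require Import structures.
From mathcomp Require Import all_boot all_order all_algebra.
From mathcomp Require Import all_classical all_reals all_analysis.
From mathcomp Require Import measurable_realfun ring lra.

Set Implicit Arguments.
Unset Strict Implicit.
Unset Printing Implicit Defensive.

Import Order.TTheory GRing.Theory Num.Theory.
Import numFieldNormedType.Exports.

Local Open Scope classical_set_scope.
Local Open Scope ring_scope.

(** * Positive random variables and the mean of a reciprocal *)

Lemma measurable_fun_inv_ge0 (R : realType) (d : measure_display)
    (T : measurableType d) (g : T -> R) :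
  (forall t, 0 <= g t) -> measurable_fun [set: T] g ->
  measurable_fun [set: T] (fun t => (g t)^-1).
Proof.
(* Inversion is the power with exponent [-1], even where [g] vanishes, since both sides are then
   [0]. *)
move=> g0 mg; under eq_fun do rewrite -powR_inv1//.
exact: measurableT_comp (measurable_powR (-1)) mg.
Qed.

(** A zero mean would force [Z = 0] almost surely, making the whole space negligible although its
    probability is [1]. *)
Lemma expectation_gt0 (R : realType) (d : measure_display)
    (T : measurableType d) (P : probability T R) (Z : T -> R) :
  measurable_fun [set: T] Z -> (forall w, 0 <= Z w) ->
  {ae P, forall w, 0 < Z w} -> (0 < 'E_P[Z])%E.
Proof.
move=> mZ Z0 Zgt0; rewrite expectation.unlock.
have EZ0 : (0 <= \int[P]_w (Z w)%:E)%E.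
  by apply: integral_ge0 => w _; rewrite lee_fin.
rewrite lt_neqAle EZ0 andbT; apply/negP => /eqP EZ.
have : ae_eq P setT (EFin \o Z) (cst 0%E).
  apply/(ae_eq_integral_abs P measurableT) => //; first exact/measurable_EFinP.
  by rewrite EZ; apply: eq_integral => w _ /=; rewrite ger0_norm.
move=> Zeq0; have : {ae P, forall w : T, False}.
  move: Zgt0 Zeq0; apply: filterS2 => w Zw /(_ I) [Z0w].
  by move: Zw; rewrite Z0w ltxx.
case=> N [mN N0 NT]; have PT : P setT = 1%E := probability_setT P.
have : P setT = 0%E.
  by apply: (subset_measure0 _ mN _ N0) => // w _; apply: NT => /=; case.
by rewrite PT => /eqP; rewrite onee_eq0.
Qed.

(* Integrate the identity (Z - m)^2 / Z + 2 m = Z + m^2 / Z for m = E[Z]. *)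
Lemma expectation_inv_ge (R : realType) (d : measure_display)
    (T : measurableType d) (P : probability T R) (Z : T -> R) :
  measurable_fun [set: T] Z -> (forall w, 0 <= Z w) ->
  {ae P, forall w, 0 < Z w} ->
  ('E_P[Z] < +oo)%E -> ('E_P[(fun w => 1 / Z w)%R] < +oo)%E ->
  ('E_P[(fun w => 1 / Z w)%R] >= 1 / 'E_P[Z])%E /\
  (('E_P[(fun w => 1 / Z w)%R] = 1 / 'E_P[Z])%E <->
   {ae P, forall w, Z w = fine 'E_P[Z]}).
Proof.
move=> mZ Z0 Zgt0; rewrite expectation.unlock => EZ EV.
have PT : P setT = 1%E := probability_setT P.
have mV : measurable_fun [set: T] (fun w => 1 / Z w).
  under eq_fun do rewrite div1r.
  exact: measurable_fun_inv_ge0.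
have EZ0 : (0 <= \int[P]_w (Z w)%:E)%E.
  by apply: integral_ge0 => w _; rewrite lee_fin.
have EV0 : (0 <= \int[P]_w (1 / Z w)%:E)%E.
  by apply: integral_ge0 => w _; rewrite lee_fin divr_ge0.
pose m := fine (\int[P]_w (Z w)%:E)%E.
have mE : (\int[P]_w (Z w)%:E = m%:E)%E by rewrite fineK ?ge0_fin_numE.
pose v := fine (\int[P]_w (1 / Z w)%:E)%E.
have vE : (\int[P]_w (1 / Z w)%:E = v%:E)%E by rewrite fineK ?ge0_fin_numE.
have m0 : 0 < m.
  by have := expectation_gt0 mZ Z0 Zgt0; rewrite expectation.unlock mE lte_fin.
pose Y w := (Z w - m) ^+ 2 / Z w.
have Y0 w : 0 <= Y w by rewrite divr_ge0// sqr_ge0.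
have mY : measurable_fun [set: T] Y.
  apply: measurable_funM; last exact: measurable_fun_inv_ge0.
  by apply: measurable_funX; exact: measurable_funB.
(* Without subtractions, both sides are integrals of nonnegative functions, for which additivity
   needs no integrability of [Y]. *)
have EY : (\int[P]_w (Y w)%:E + (2 * m)%:E = m%:E + (m ^+ 2 * v)%:E)%E.
  transitivity (\int[P]_w ((Y w)%:E + (2 * m)%:E))%E.
    rewrite ge0_integralD//; last 3 first.
    - by move=> w _; rewrite lee_fin.
    - exact/measurable_EFinP.
    - by move=> w _; rewrite lee_fin mulr_ge0// ltW.
    by rewrite integral_cst// -[in LHS](mule1 (2 * m)%:E) -PT.
  transitivity (\int[P]_w ((Z w)%:E + (m ^+ 2)%:E * (1 / Z w)%:E))%E; last first.
    rewrite ge0_integralD//; last 4 first.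
    - by move=> w _; rewrite lee_fin.
    - exact/measurable_EFinP.
    - by move=> w _; rewrite -EFinM lee_fin mulr_ge0 ?sqr_ge0// divr_ge0.
    - by apply: measurable_funeM; exact/measurable_EFinP.
    rewrite mE ge0_integralZl_EFin// ?vE ?sqr_ge0//.
      by move=> w _; rewrite lee_fin divr_ge0.
    exact/measurable_EFinP.
  apply: ge0_ae_eq_integral => //.
  - by apply: emeasurable_funD => //; exact/measurable_EFinP.
  - apply: emeasurable_funD; first exact/measurable_EFinP.
    by apply: measurable_funeM; exact/measurable_EFinP.
  - by move=> w _; rewrite -EFinD lee_fin addr_ge0// mulr_ge0// ltW.
  - move=> w _; rewrite -EFinM -EFinD lee_fin addr_ge0//.
    by rewrite mulr_ge0 ?sqr_ge0// divr_ge0.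
  apply: filterS Zgt0 => w Zw _; rewrite -EFinM -!EFinD; congr EFin.
  by rewrite /Y; field; rewrite gt_eqF.
have EY0 : (0 <= \int[P]_w (Y w)%:E)%E.
  by apply: integral_ge0 => w _; rewrite lee_fin.
(* The right-hand side of [EY] is finite, so the integral of [Y] is a real number and [EY] can be
   solved for it. *)
have : (\int[P]_w (Y w)%:E)%E = (m ^+ 2 * v - m)%:E.
  move: EY EY0; case: (\int[P]_w (Y w)%:E)%E => // y [] + _.
  by move=> yE; congr EFin; lra.
rewrite mE vE inver gt_eqF// mul1e => yE.
(* Since [m > 0], the gap [v - m^-1] has the sign of the mean of [Y] and vanishes exactly when that
   mean does. *)
have vm : m ^+ 2 * v - m = m ^+ 2 * (v - m^-1).
  by field; rewrite gt_eqF.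
split.
  by move: EY0; rewrite yE vm !lee_fin pmulr_rge0 ?exprn_gt0// subr_ge0.
rewrite /=; split=> [[vm1]|Zm].
  have : ae_eq P setT (EFin \o Y) (cst 0%E).
    apply/(ae_eq_integral_abs P measurableT) => //; first exact/measurable_EFinP.
    transitivity (\int[P]_w (Y w)%:E)%E.
      by apply: eq_integral => w _ /=; rewrite ger0_norm.
    by rewrite yE vm vm1 subrr mulr0.
  move: Zgt0; apply: filterS2 => w Zw /(_ I) [] /eqP.
  rewrite mulf_eq0 invr_eq0 (gt_eqF Zw) orbF sqrf_eq0 subr_eq0.
  by move/eqP.
have : (\int[P]_w (Y w)%:E)%E = 0%E.
  transitivity (\int[P]_w `|(Y w)%:E|)%E.
    by apply: eq_integral => w _ /=; rewrite ger0_norm.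
  apply/(ae_eq_integral_abs P measurableT) => //; first exact/measurable_EFinP.
  by apply: filterS Zm => w Zw _; rewrite /= /Y Zw subrr expr0n mul0r.
rewrite yE vm => /eqP; rewrite eqe mulf_eq0 sqrf_eq0 gt_eqF//= subr_eq0.
by move/eqP => ->.
Qed.

(** * Passing between almost every point and almost surely *)

Lemma ae_density_comp (R : realType) (d : measure_display)
    (T : measurableType d) (P : probability T R) (X : {RV P >-> R})
    (f : R -> R) (Q : R -> Prop) :
  is_density X f -> {ae @lebesgue_measure R, forall t, f t != 0 -> Q t} ->
  {ae P, forall w, Q (X w)}.
Proof.
move=> [mf f0 fX] [N [mN N0 NQ]].
have mf0 : measurable [set t | f t = 0].
  by rewrite -[X in measurable X]setTI; exact: (mf measurableT [set 0]).
(* The law of [X] charges neither the Lebesgue-null set [N] nor the zero set of [f], and outside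
   both [Q] holds. *)
exists (X @^-1` (N `|` [set t | f t = 0])); split.
- by apply: measurable_funPTI; exact: measurableU.
- change (distribution P X (N `|` [set t | f t = 0]) = 0%E).
  apply/eqP; rewrite eq_le measure_ge0 andbT.
  apply: le_trans; first exact: measureU2.
  rewrite [X in (X + _ <= _)%E](fX _ mN) [X in (_ + X <= _)%E](fX _ mf0).
  rewrite null_set_integral//; last first.
    by apply/measurable_EFinP; exact: measurable_funTS.
  by rewrite add0e integral0_eq// => t /= ->.
- move=> w /= nQ; have [f0w|f0w] := eqVneq (f (X w)) 0; first by right.
  by left; apply: NQ => /= /(_ f0w).
Qed.

(** The integral of [f] over the complement of [Q] is the probability that [X] falls there, which is
    zero, so [f] vanishes almost everywhere on that complement. *)
Lemma ae_comp_density (R : realType) (d : measure_display)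
    (T : measurableType d) (P : probability T R) (X : {RV P >-> R})
    (f : R -> R) (Q : set R) :
  is_density X f -> measurable Q -> {ae P, forall w, Q (X w)} ->
  {ae @lebesgue_measure R, forall t, f t != 0 -> Q t}.
Proof.
move=> [mf f0 fX] mQ [N [mN N0 NQ]].
have mfQ : measurable_fun (~` Q) (EFin \o f).
  by apply/measurable_EFinP; exact: measurable_funTS.
have fQ0 : (\int[lebesgue_measure]_(t in ~` Q) `|(f t)%:E|)%E = 0%E.
  transitivity (distribution P X (~` Q)).
    rewrite fX; last exact: measurableC.
    by apply: eq_integral => t _ /=; rewrite ger0_norm.
  change (P (X @^-1` (~` Q)) = 0%E).
  apply: (subset_measure0 _ mN _ N0) => //.
  by apply: measurable_funPTI; exact: measurableC.
have := (ae_eq_integral_abs lebesgue_measure (measurableC mQ) mfQ).1 fQ0.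
apply: filterS => t /= fQ f0t; apply: contrapT => nQ.
by move: f0t; case: (fQ nQ) => ->; rewrite eqxx.
Qed.

(** * The distribution function as an integral of the density *)

Lemma integrable_density (R : realType) (d : measure_display)
    (T : measurableType d) (P : probability T R) (X : {RV P >-> R})
    (f : R -> R) (A : set R) :
  is_density X f -> measurable A ->
  (@lebesgue_measure R).-integrable A (EFin \o f).
Proof.
move=> [mf f0 fX] mA; apply: (@integrableS _ _ _ _ setT) => //.
apply/integrableP; split; first exact/measurable_EFinP.
rewrite (_ : (\int[_]_(x in _) _)%E = distribution P X setT).
  by rewrite probability_setT ltry.
by rewrite fX//; apply: eq_integral => t _ /=; rewrite ger0_norm.
Qed.

Lemma fine_cdf_Rintegral (R : realType) (d : measure_display)
    (T : measurableType d) (P : probability T R) (X : {RV P >-> R})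
    (f : R -> R) :
  is_density X f ->
  fine \o cdf X = fun x => \int[lebesgue_measure]_(t in `]-oo, x]) f t.
Proof. by move=> [mf f0 fX]; apply/funext => x /=; rewrite /cdf fX. Qed.

(** Lebesgue's differentiation theorem for the integral of [f] from minus infinity. *)
Lemma fine_cdf_is_derive_ae (R : realType) (d : measure_display)
    (T : measurableType d) (P : probability T R) (X : {RV P >-> R})
    (f : R -> R) :
  is_density X f ->
  {ae @lebesgue_measure R, forall t : R, is_derive t (1 : R) (fine \o cdf X) (f t)}.
Proof.
move=> hf; rewrite (fine_cdf_Rintegral hf).
have fi A := @integrable_density _ _ _ _ _ _ A hf.
have : locally_integrable setT f.
  by apply: open_integrable_locally => //; [exact: openT|exact: fi].
move/(FTC1Ny (fun y => fi _ (measurable_itv `]-oo, y]))).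
apply: filterS;
  first exact: (ae_filter_ringOfSetsType lebesgue_measure).
by move=> t [? ft]; apply: DeriveDef => //; rewrite -derive1E.
Qed.

Lemma fine_cdf_ge0 (R : realType) (d : measure_display)
    (T : measurableType d) (P : probability T R) (X : {RV P >-> R}) (x : R) :
  0 <= fine (cdf X x).
Proof. exact/fine_ge0/cdf_ge0. Qed.

(** Absolute continuity of the integral: an increment of the distribution function is the integral
    of [f] over an interval, hence small when the interval is short. *)
Lemma fine_cdf_continuous (R : realType) (d : measure_display)
    (T : measurableType d) (P : probability T R) (X : {RV P >-> R})
    (f : R -> R) :
  is_density X f -> continuous (fine \o cdf X).
Proof.
move=> hf x; have [mf f0 fX] := hf.
have fi A := @integrable_density _ _ _ _ _ _ A hf.
rewrite (fine_cdf_Rintegral hf); apply/cvgrPdist_lt => /= e e0.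
have [r [r0 rf]] := integral_normr_continuous (fi _ measurableT) e0.
have lt_e y z : y <= z -> z - y < r ->
    `|\int[lebesgue_measure]_(t in `]-oo, z]) f t -
      \int[lebesgue_measure]_(t in `]-oo, y]) f t| < e.
  move=> yz zyr; rewrite Rintegral_itvB//; last exact: fi.
  apply: le_lt_trans (rf `]y, z]%classic _ _) => //.
    by apply: le_normr_Rintegral => //; exact: fi.
  suff : (@lebesgue_measure R `]y, z] < r%:E)%E by [].
  rewrite lebesgue_measure_itv/= lte_fin; case: ifPn => _.
    by rewrite -EFinD lte_fin.
  by rewrite lte_fin.
exists r => //= y /=; rewrite ltr_distl => /andP[xy yx].
have [xley|/ltW ylex] := leP x y; last by apply: lt_e => //; lra.
by rewrite distrC; apply: lt_e => //; lra.
Qed.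

(** The difference quotients from the left are all zero, and the derivative is also their one-sided
    limit. *)
Lemma is_derive_const_at_left (R : realType) (g : R -> R) (t c : R) :
  is_derive t 1 g c -> (forall s, s < t -> g s = g t) -> c = 0.
Proof.
move=> [gt <-] gc.
have dg : (fun h : R => h^-1 *: ((g \o shift t) (h *: 1) - g t)) h
    @[h --> 0^'] --> 'D_1 g t by exact: gt.
apply: (cvg_unique _ (cvg_dnbhs_at_left dg)); first exact: Rhausdorff.
apply: cvg_near_cst; near=> h; rewrite /= gc ?subrr ?scaler0//.
by rewrite [_ *: _]mulr1 gtrDr; near: h; exact: nbhs_left_lt.
Unshelve. all: by end_near. Qed.

(** Mirror image, meant for points from [b] on, where the distribution function stays at [1]. *)
Lemma is_derive_const_at_right (R : realType) (g : R -> R) (t c : R) :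
  is_derive t 1 g c -> (forall s, t < s -> g s = g t) -> c = 0.
Proof.
move=> [gt <-] gc.
have dg : (fun h : R => h^-1 *: ((g \o shift t) (h *: 1) - g t)) h
    @[h --> 0^'] --> 'D_1 g t by exact: gt.
apply: (cvg_unique _ (cvg_dnbhs_at_right dg)); first exact: Rhausdorff.
apply: cvg_near_cst; near=> h; rewrite /= gc ?subrr ?scaler0//.
by rewrite [_ *: _]mulr1 ltrDr; near: h; exact: nbhs_right_gt.
Unshelve. all: by end_near. Qed.

(* Where the distribution function vanishes, it also vanishes on the left, so
   its derivative, which is the density almost everywhere, vanishes too. *)
Lemma ae_cdf_gt0 (R : realType) (d : measure_display)
    (T : measurableType d) (P : probability T R) (X : {RV P >-> R})
    (f : R -> R) :
  is_density X f ->
  {ae @lebesgue_measure R, forall t, f t != 0 -> 0 < fine (cdf X t)}.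
Proof.
move=> hf; have := fine_cdf_is_derive_ae hf.
apply: filterS;
  first exact: (ae_filter_ringOfSetsType lebesgue_measure).
move=> t Ft; rewrite lt_neqAle fine_cdf_ge0 andbT.
apply: contra_neq => F0; apply: (is_derive_const_at_left Ft) => s st /=.
rewrite -F0; apply/le_anti; rewrite fine_cdf_ge0 andbT F0.
by rewrite fine_le ?fin_num_measure// cdf_nondecreasing// ltW.
Qed.

Lemma fine_cdf_support_sup (R : realType) (d : measure_display)
    (T : measurableType d) (P : probability T R) (X : {RV P >-> R})
    (b x : R) :
  b%:E = ereal_sup (EFin @` [set t : R | (cdf X t < 1)%E]) ->
  b <= x -> fine (cdf X x) = 1.
Proof.
move=> bsup.
have lt1 y : b < y -> fine (cdf X y) = 1.
  move=> b_y; apply: EFin_inj; rewrite fineK ?fin_num_measure//.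
  apply/le_anti; rewrite cdf_le1/= leNgt; apply/negP => Fy1.
  have : (y%:E <= b%:E)%E by rewrite bsup; apply: ereal_sup_ubound; exists y.
  by rewrite lee_fin leNgt b_y.
rewrite le_eqVlt => /predU1P[<-|/lt1//].
(* The supremum settles only the points beyond [b]; the value at [b] itself follows by right
   continuity. *)
have Fb : (fine \o cdf X) y @[y --> b^'+] --> fine (cdf X b).
  by apply: fine_cvg; rewrite fineK ?fin_num_measure//; exact: cdf_right_continuous.
apply: (cvg_unique (@Rhausdorff R) Fb).
apply: cvg_near_cst; near=> y; rewrite /= lt1//.
Unshelve. all: by end_near. Qed.

Lemma density_ae_eq (R : realType) (d : measure_display)
    (T : measurableType d) (P : probability T R) (X : {RV P >-> R})
    (f g : R -> R) :
  is_density X f -> measurable_fun [set: R] g -> (forall t, 0 <= g t) ->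
  {ae @lebesgue_measure R, forall t : R, f t = g t} -> is_density X g.
Proof.
move=> [mf f0 fX] mg g0 fg; split=> // A mA; rewrite fX//.
apply: ge0_ae_eq_integral => //.
- by apply/measurable_EFinP; exact: measurable_funTS.
- by apply/measurable_EFinP; exact: measurable_funTS.
- by move=> t _; rewrite lee_fin.
- by move=> t _; rewrite lee_fin.
- move: fg; apply: filterS;
    first exact: (ae_filter_ringOfSetsType lebesgue_measure).
  by move=> t /= ->.
Qed.

(** At a continuity point of the density, the fundamental theorem of calculus gives the derivative
    at that very point rather than almost everywhere. *)
Lemma is_derive_fine_cdf (R : realType) (d : measure_display)
    (T : measurableType d) (P : probability T R) (X : {RV P >-> R})
    (f : R -> R) (x : R) :
  is_density X f -> {for x, continuous f} ->
  is_derive x (1 : R) (fine \o cdf X) (f x).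
Proof.
move=> hf fx; rewrite (fine_cdf_Rintegral hf).
have fi A := @integrable_density _ _ _ _ _ _ A hf.
have x1 : x < x + 1 by rewrite ltrDl.
have [? dF] := continuous_FTC1 x1 (fi _ (measurable_itv `]-oo, x + 1])) (ltNyr x) fx.
by apply: DeriveDef => //; rewrite -derive1E.
Qed.

(** * The differential equation, and the left end of the support *)

Lemma powRN_continuous (R : realType) (a : R) :
  0 < a -> continuous (fun t => a `^ (- t)).
Proof.
move=> a0; rewrite (_ : (fun t => _) = expR \o (fun t => - t * ln a)).
  move=> t; apply: continuous_comp; last exact: continuous_expR.
  by apply: cvgM; [exact: cvgN|exact: cvg_cst].
by apply/funext => t; rewrite /powR gt_eqF.
Qed.

Lemma is_derive_expR_powRN (R : realType) (a k c x : R) : 0 < a ->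
  is_derive x (1 : R) (fun y => expR (k * (a `^ (- y) - c)))
    (- (k * ln a) * a `^ (- x) * expR (k * (a `^ (- x) - c))).
Proof.
move=> a0; have aE y : a `^ (- y) = expR (- y * ln a) by rewrite /powR gt_eqF.
rewrite aE; under eq_fun do rewrite aE.
by apply: trigger_derive; rewrite /GRing.scale/=; ring.
Qed.

(* The product of F with the reciprocal of the claimed solution is constant. *)
Lemma powRN_ode (R : realType) (F : R -> R) (a b c : R) :
  1 < a -> continuous F -> F b = 1 ->
  (forall x : R, x < b -> is_derive x (1 : R) F (c * a `^ (- x) * F x)) ->
  forall x, x <= b -> F x = expR (- (c / ln a) * (a `^ (- x) - a `^ (- b))).
Proof.
move=> a1 Fc Fb dF x xb; have a0 : 0 < a by apply: lt_trans a1.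
have lna : ln a != 0 by rewrite gt_eqF// ln_gt0.
pose E y := expR ((c / ln a) * (a `^ (- y) - a `^ (- b))).
have dE (y : R) : is_derive y (1 : R) E (- (c / ln a * ln a) * a `^ (- y) * E y).
  exact: is_derive_expR_powRN.
have dG (y : R) : y \in `]x, b[ -> is_derive y (1 : R) (F * E) 0.
  rewrite in_itv/= => /andP[_ yb]; have dFy := dF _ yb.
  apply: is_derive_eq; rewrite /GRing.scale/= divfK//; ring.
(* Differentiability is known only left of [b]; continuity up to [b] lets the mean value theorem
   reach the boundary value [F b = 1]. *)
have cG : {within `[x, b], continuous (F * E)}.
  apply: continuous_subspaceT => y; apply: continuousM; first exact: Fc.
  by apply/differentiable_continuous/derivable1_diffP; case: (dE y).
have [y _ ] := MVT_segment xb dG cG.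
rewrite mul0r => /eqP; rewrite subr_eq0 => /eqP.
rewrite /= -[(F * E) b]/(F b * E b) -[(F * E) x]/(F x * E x).
rewrite Fb /E subrr mulr0 expR0 mulr1 => FE.
by rewrite mulNr expRN -[RHS]mul1r FE mulfK// gt_eqF// expR_gt0.
Qed.

(** The inequality is strict because, by continuity, the distribution function is still positive
    slightly to the left of [t]. *)
Lemma support_inf_lt (R : realType) (d : measure_display)
    (T : measurableType d) (P : probability T R) (X : {RV P >-> R})
    (f : R -> R) (l : \bar R) (t : R) :
  is_density X f ->
  l = ereal_inf (EFin @` [set t : R | (0 < cdf X t)%E]) ->
  0 < fine (cdf X t) -> (l < t%:E)%E.
Proof.
move=> hf linf Ft.
have /cvg_at_left_filter Fl := @fine_cdf_continuous _ _ _ _ _ _ hf t.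
have [s [Fs st]] : exists s, 0 < fine (cdf X s) /\ s < t.
  near t^'- => s; exists s; split.
    by near: s; exact: (cvgr_gt _ Fl).
  by near: s; exact: nbhs_left_lt.
apply: le_lt_trans (_ : (s%:E < _)%E); last by rewrite lte_fin.
rewrite linf; apply: ereal_inf_lbound; exists s => //=.
by rewrite -[cdf X s]fineK ?fin_num_measure// lte_fin.
Unshelve. all: by end_near. Qed.

(** * The inequality and the case of equality *)

Theorem theorem2p5 (R : realType) (d : measure_display) (T : measurableType d)
    (P : probability T R) (a : R) (X : {RV P >-> R}) (f : R -> R)
    (l : \bar R) (b : R)
    (ha : 1 < a)
    (hf : is_density X f)
    (hlb : (l < b%:E)%E)
    (hsupp : has_support X f l b%:E)
    (hX2 : ('E_P[(fun w => X w ^+ 2)%R] < +oo)%E)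
    (hE : ('E_P[(fun w => a `^ X w * reversed_hazard_rate X f (X w))%R]
            < +oo)%E)
    (hEV : ('E_P[(fun w => 1 / (a `^ X w * reversed_hazard_rate X f (X w)))%R]
            < +oo)%E) :
  ('E_P[(fun w => 1 / (a `^ X w * reversed_hazard_rate X f (X w)))%R]
     >= 1 / 'E_P[(fun w => a `^ X w * reversed_hazard_rate X f (X w))%R])%E
  /\
  (('E_P[(fun w => 1 / (a `^ X w * reversed_hazard_rate X f (X w)))%R]
     = 1 / 'E_P[(fun w => a `^ X w * reversed_hazard_rate X f (X w))%R])%E
   <->
   exists theta : R, 0 < theta /\
     forall x : R, x <= b ->
       cdf X x = (expR (- theta * (a `^ (- x) - a `^ (- b))))%:E).
Proof.
have a0 : 0 < a by apply: lt_trans ha.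
have lna0 : 0 < ln a by rewrite ln_gt0.
have [mf f0 fX] := hf; case: hsupp => linf bsup fpos.
pose F := fine \o cdf X.
have cF : continuous F := fine_cdf_continuous hf.
have mF : measurable_fun [set: R] F by exact: continuous_measurable_fun.
pose z t := a `^ t * reversed_hazard_rate X f t.
have zE t : z t = a `^ t * (f t / F t) by [].
have z0 t : 0 <= z t.
  by rewrite mulr_ge0 ?powR_ge0// divr_ge0// fine_cdf_ge0.
have mz : measurable_fun [set: R] z.
  apply: measurable_funM; first exact: measurable_powRr.
  apply: measurable_funM => //.
  by apply: measurable_fun_inv_ge0 => // t; exact: fine_cdf_ge0.
pose Z := z \o X.
have mZ : measurable_fun [set: T] Z by exact: measurableT_comp mz _.
have F0 := ae_cdf_gt0 hf.
have Z0 : {ae P, forall w, 0 < Z w}.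
  apply: (@ae_density_comp _ _ _ _ X f (fun t => 0 < z t) hf).
  move: F0; apply: filterS;
    first exact: (ae_filter_ringOfSetsType lebesgue_measure).
  move=> t Ft ft; rewrite zE mulr_gt0 ?powR_gt0// divr_gt0 ?Ft//.
  by rewrite lt_neqAle eq_sym ft f0.
have [ineq eqiff] := expectation_inv_ge mZ (fun w => z0 (X w)) Z0 hE hEV.
split; first exact: ineq.
apply: (iff_trans eqiff).
have m0 : 0 < fine 'E_P[Z]%E.
  apply: fine_gt0; rewrite hE andbT.
  exact: expectation_gt0 mZ (fun w => z0 (X w)) Z0.
have Fb x : b <= x -> F x = 1 by exact: fine_cdf_support_sup.
set m := fine 'E_P[Z]%E in m0 *; split=> [Zm|[theta [theta0 cdfE]]].
  have mQ : measurable [set t | z t = m].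
    by rewrite -[X in measurable X]setTI; exact: (mz measurableT [set m]).
  have zm := @ae_comp_density _ _ _ _ X f [set t | z t = m] hf mQ Zm.
  (* A version of the density that is continuous left of [b]: with it, the differential equation
     holds at every point there, not just almost everywhere. *)
  pose g t := if t < b then m * a `^ (- t) * F t else f t.
  have hg : is_density X g.
    apply: (density_ae_eq hf).
    - apply: measurable_fun_ifT => //.
        exact: measurable_fun_ltr.
      apply: measurable_funM => //; apply: measurable_funM => //.
      exact: measurableT_comp (measurable_powRr a) _.
    - move=> t; rewrite /g; case: ifPn => // _.
      by rewrite mulr_ge0 ?fine_cdf_ge0// mulr_ge0 ?powR_ge0// ltW.
    move: fpos F0 zm; apply: filterS3;
      first exact: (ae_filter_ringOfSetsType lebesgue_measure).
    move=> t fpos F0 zm; rewrite /g; case: ifPn => // tb.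
    (* The constancy of [Z] says nothing where [f] vanishes. There [F t] must be [0]: otherwise [t]
       would lie in the support, where [f] is positive. *)
    have [ft|ft] := eqVneq (f t) 0.
      suff -> : F t = 0 by rewrite mulr0.
      apply/eqP; apply: contraT => Ft.
      have : 0 < f t.
        apply: fpos; last by rewrite lte_fin.
        apply: (support_inf_lt hf) => //.
        by rewrite lt_neqAle eq_sym Ft fine_cdf_ge0.
      by rewrite ft ltxx.
    have Ft : F t != 0 by rewrite gt_eqF// F0.
    rewrite -(zm ft) zE powRN; field.
    by rewrite Ft gt_eqF// powR_gt0.
  exists (m / ln a); split; first by rewrite divr_gt0.
  move=> x xb; rewrite -[cdf X x]fineK ?fin_num_measure//; congr EFin.
  apply: (powRN_ode ha cF) => // [|y yb]; first exact: Fb.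
  have gE : \forall t \near y, m * a `^ (- t) * F t = g t.
    by near=> t; rewrite /g ifT//; near: t; exact: lt_nbhsl.
  have -> : m * a `^ (- y) * F y = g y by exact: nbhs_singleton gE.
  apply: is_derive_fine_cdf => //.
  rewrite /prop_for /continuous_at -(nbhs_singleton gE).
  apply: cvg_trans; first exact: near_eq_cvg gE.
  apply: cvgM; last exact: cF.
  apply: cvgM; first exact: cvg_cst.
  exact: powRN_continuous.
have Zc : {ae P, forall w, Z w = theta * ln a}.
  apply: (@ae_density_comp _ _ _ _ X f (fun t => z t = theta * ln a) hf).
  have := fine_cdf_is_derive_ae hf.
  move: F0; apply: filterS2;
    first exact: (ae_filter_ringOfSetsType lebesgue_measure).
  move=> t F0 dF ft; have [tb|bt] := ltP t b; last first.
    (* From [b] on, [F] is constantly [1], so its derivative [f t] is zero. *)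
    have ft0 : f t = 0; last by rewrite ft0 eqxx in ft.
    apply: (is_derive_const_at_right dF) => s ts.
    by rewrite -/F !Fb// (le_trans bt)// ltW.
  have dH := is_derive_expR_powRN (- theta) (a `^ (- b)) t a0.
  (* As [t < b], the closed form holds on a whole neighbourhood of [t], so it can be differentiated
     to find [f t]. *)
  have FH : \forall s \near t, expR (- theta * (a `^ (- s) - a `^ (- b))) = F s.
    near=> s; rewrite /F/= cdfE//.
    by apply/ltW; near: s; exact: lt_nbhsl.
  have fE : f t = theta * ln a * a `^ (- t) * F t.
    rewrite -(nbhs_singleton FH) -[X in X * ln a]opprK mulNr.
    rewrite -(@derive_val _ _ _ _ _ _ _ dH).
    by rewrite (near_eq_derive _ FH); apply/esym; exact: derive_val.
  rewrite zE fE powRN; field.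
  by rewrite (lt0r_neq0 (F0 ft) : F t != 0) lt0r_neq0 ?powR_gt0.
(* The criterion compares [Z] with its own mean, so the constant [theta * ln a] must be identified
   with [m] by integrating it over a space of mass [1]. *)
suff mE : m = theta * ln a by rewrite mE.
rewrite /m expectation.unlock.
rewrite (@ae_eq_integral _ _ _ P setT (cst (theta * ln a)%:E))//.
- rewrite integral_cst// -[RHS]/(fine (theta * ln a)%:E).
  by rewrite -[in RHS](mule1 (_ * _)%:E) -(probability_setT P).
- exact/measurable_EFinP.
- by apply: filterS Zc => w -> _.
Unshelve. all: by end_near. Qed.
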